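(* Let $P$ be a finite poset and let $A$ be an antichain of $P$ containing no pair $u,v \in A$ with $u \prec v$. Then the distributive lattice $J(P)$ has the Boolean algebra decomposition $$J(P) = \bigcup_{I \in J''(P)} [I, \psi(I)],$$ that is, $J(P)$ is the union of the intervals $[I,\psi(I)]$ for $I \in J''(P)$, these intervals are pairwise disjoint, and each is isomorphic to a Boolean algebra.
   Context: $J(P)$ denotes the set of lower order ideals (down-sets) of $P$, ordered by inclusion; intervals $[I,I']$ are taken in $J(P)$. $J''(P)$ is the set of $I \in J(P)$ having no maximal element (maximal within $I$) lying in $A$. For $I \in J(P)$, $\psi(I) = I \cup \{a \in A : I \cup \{a\} \in J(P)\}$. *)

(* Defs.v *)
From HB Require Import structures.
From mathcomp Require Import all_boot all_order.
From mathcomp Require Import interval.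

Set Implicit Arguments.
Unset Strict Implicit.
Unset Printing Implicit Defensive.

Import Order.TTheory Order.DefaultSetSubsetOrder.
Local Open Scope order_scope.

Section Downsets.
Context {d : Order.disp_t} {P : finPOrderType d}.
Implicit Types (x y : P) (A : {set P}).

Definition antichain A := {in A &, forall u v, u <= v -> u = v}.

Definition is_downset (I : {set P}) : bool :=
  [forall x in I, forall y, (y <= x) ==> (y \in I)].

Lemma is_downsetP (I : {set P}) :
  reflect (forall x y, x \in I -> y <= x -> y \in I) (is_downset I).
Proof.
apply: (iffP forall_inP) => [H x y xI yx | H x xI].
  by have /forallP/(_ y)/implyP := H x xI; apply.
by apply/forallP => y; apply/implyP; apply: H.
Qed.

Definition maximal_in (I : {set P}) x :=
  (x \in I) && [forall y in I, ~~ (x < y)].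

End Downsets.

Record J (d : Order.disp_t) (P : finPOrderType d) := MkJ {
  ideal_set :> {set P};
  _ : is_downset ideal_set
}.

Section IdealLattice.
Context {d : Order.disp_t} {P : finPOrderType d}.

HB.instance Definition _ := [isSub for @ideal_set d P].
HB.instance Definition _ := [Finite of J P by <:].

Fact downsetI (I1 I2 : {set P}) :
  is_downset I1 -> is_downset I2 -> is_downset (I1 :&: I2).
Proof.
move=> /is_downsetP H1 /is_downsetP H2; apply/is_downsetP => x y.
move=> /setIP[x1 x2] yx; apply/setIP; split; [exact: H1 yx | exact: H2 yx].
Qed.

Fact downsetU (I1 I2 : {set P}) :
  is_downset I1 -> is_downset I2 -> is_downset (I1 :|: I2).
Proof.
move=> /is_downsetP H1 /is_downsetP H2; apply/is_downsetP => x y.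
by move=> /setUP[xI|xI] yx; apply/setUP; [left; apply: H1 yx | right; apply: H2 yx].
Qed.

Fact downset0 : is_downset (set0 : {set P}).
Proof. by apply/is_downsetP => x y; rewrite in_set0. Qed.

Fact downsetT : is_downset [set: P].
Proof. by apply/is_downsetP => x y; rewrite !in_setT. Qed.

HB.instance Definition _ :=
  Order.SubChoice_isTBSubLattice.Build _ {set P} (@is_downset d P)
    Order.SetSubsetOrder.subset_display (J P)
    downsetI downsetU downset0 downsetT.

Fact J_meetUl : @left_distributive (J P) (J P) Order.meet Order.join.
Proof.
move=> I1 I2 I3; apply: val_inj; exact: (setIUl (val I1)).
Qed.

HB.instance Definition _ :=
  Order.Lattice_Meet_isDistrLattice.Build _ (J P) J_meetUl.

End IdealLattice.

Section Decomposition.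
Context {d : Order.disp_t} {P : finPOrderType d}.
Implicit Types (A : {set P}) (I : J P).

Definition J'' A : {set J P} :=
  [set I : J P | [forall x, maximal_in I x ==> (x \notin A)]].

Definition psi_set A I : {set P} := I :|: [set a in A | is_downset (a |: I)].

Fact psi_subproof A I : is_downset (psi_set A I).
Proof.
have /is_downsetP HI : is_downset I by case: I.
apply/is_downsetP => x y /setUP[xI|xA] yx; apply/setUP.
  by left; apply: HI yx.
move: (xA); rewrite inE => /andP[_ /is_downsetP Hx].
have /setU1P[->|yI] := Hx x y (setU11 _ _) yx; [by right | by left].
Qed.

Definition psi A I : J P := MkJ (psi_subproof A I).

Definition Jitv I I' : {set J P} := [set K in `[I, I']].

End Decomposition.

(* [S], with the order induced from [T], is isomorphic to some finite Boolean
   algebra [B] ([f] is injective because it reflects the order). *)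
Definition isom_boolean (d : Order.disp_t) (T : finPOrderType d) (S : {set T}) :=
  exists (dB : Order.disp_t) (B : finCTBDistrLatticeType dB) (f : B -> T),
    {mono f : x y / x <= y} /\ f @: [set: B] = S.

(* Main.v *)
(* For [I] in [J'' A], a down-set [K] lies in [[I, psi A I]] exactly when [I] is
   obtained from [K] by deleting the maximal elements of [K] that lie in [A];
   hence each [K] lies in exactly one interval.  The elements of [psi A I] outside [I] can
   be added to [I] independently of each other, so the interval above [I] is
   the Boolean algebra of subsets of [psi A I :\: I]. *)
Require Import Defs.
From mathcomp Require Import all_boot all_order.
From mathcomp Require Import interval.

Set Implicit Arguments.
Unset Strict Implicit.
Unset Printing Implicit Defensive.

Import Order.TTheory Order.DefaultSetSubsetOrder.
Local Open Scope order_scope.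

Section IdealIntervals.
Context {d : Order.disp_t} {P : finPOrderType d}.
Implicit Types (A S : {set P}) (I K : J P) (x y : P).

Lemma downsetP I x y : x \in I -> y <= x -> y \in I.
Proof. by case: I => I /= /is_downsetP; apply. Qed.

Lemma leEideal I K : (I <= K) = (I \subset K).
Proof. by []. Qed.

Lemma mem_Jitv K I I' :
  (K \in Jitv I I') = (I \subset K) && (K \subset I').
Proof. by rewrite inE in_itv /= !leEideal. Qed.

Definition core_set A K : {set P} :=
  [set x in K | ~~ ((x \in A) && maximal_in K x)].

(** An element strictly below a member of [K] is not maximal in [K], so the deletion never removes
    it. *)
Lemma lt_core_set A K x y : x \in K -> y < x -> y \in core_set A K.
Proof.
move=> xK yx; rewrite inE (downsetP xK (ltW yx)) negb_and; apply/orP; right.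
rewrite negb_and negb_forall_in; apply/orP; right.
by apply/exists_inP; exists x; rewrite ?negbK.
Qed.

Lemma core_downset A K : is_downset (core_set A K).
Proof.
apply/is_downsetP => x y xC; rewrite le_eqVlt => /predU1P[-> //|].
by apply: lt_core_set; move: xC; rewrite inE => /andP[].
Qed.

Definition core A K : J P := MkJ (core_downset A K).

(** Deletion exposes no new maximal element in [A]: such an element would lie strictly below a
    deleted one, itself in [A], which the hypothesis forbids. *)
Lemma core_in_J'' A K :
  {in A &, forall u v, ~~ (u < v)} -> core A K \in J'' A.
Proof.
move=> incA; rewrite inE; apply/forallP => x; apply/implyP.
move=> /andP[]; rewrite /= inE => /andP[xK xmaxN] /forall_inP xmaxC.
apply: contra xmaxN => xA; rewrite xA /maximal_in xK; apply/forall_inP => y yK.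
have [yC | ] := boolP (y \in core_set A K); first exact: xmaxC.
by rewrite inE yK negbK => /andP[yA _]; apply: incA.
Qed.

(** Everything strictly below a deleted element survives in the core, so each deleted element can be
    put back on its own. *)
Lemma mem_Jitv_core A K : K \in Jitv (core A K) (psi A (core A K)).
Proof.
rewrite mem_Jitv /=; apply/andP; split; apply/subsetP => x.
  by rewrite inE => /andP[].
move=> xK; apply/setUP; have [|xC] := boolP (x \in core_set A K); first by left.
right; have xA : x \in A by move: xC; rewrite inE xK negbK => /andP[].
rewrite inE xA; apply/is_downsetP => y z /setU1P[->|yC] zy; apply/setU1P.
  move: zy; rewrite le_eqVlt => /predU1P[->|zx]; first by left.
  by right; apply: lt_core_set zx.
by right; apply: downsetP yC zy.
Qed.

Lemma Jitv_coreE A I K : {in A &, forall u v, ~~ (u < v)} ->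
  I \in J'' A -> K \in Jitv I (psi A I) -> core A K = I.
Proof.
move=> incA; rewrite inE => /forallP maxI.
rewrite mem_Jitv => /andP[/subsetP IK /subsetP Kpsi].
apply/val_inj/setP => x; rewrite /= inE; apply/andP/idP => [[xK xmaxN]|xI].
  (* An element [x] of [K] outside [I] comes from [A]. Anything above it in [K] would lie in [I],
     forcing [x] into [I], or in [A], against [incA]. *)
  apply: contraNT xmaxN => xnI.
  have xA : x \in A.
    by have := Kpsi _ xK; rewrite !inE (negPf xnI) => /andP[].
  rewrite xA /maximal_in xK; apply/forall_inP => y yK; apply/negP => xy.
  have := Kpsi _ yK; rewrite !inE => /orP[yI|/andP[yA _]].
    by rewrite (downsetP yI (ltW xy)) in xnI.
  by move: (incA x y xA yA); rewrite xy.
split; first exact: IK.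
(* Since [I] is contained in [K], an element of [I] maximal in [K] is maximal in [I], hence not in
   [A]. *)
apply/negP => /andP[xA /andP[_ /forall_inP xmax]].
have /implyP := maxI x; rewrite xA => /(_ _)/negP; apply => //.
by rewrite /maximal_in xI; apply/forall_inP => y yI; apply/xmax/IK.
Qed.

(** Whatever lies strictly below an element of [S] is already in [I], so elements of [S] impose no
    condition on one another. *)
Lemma downset_setU_psi A I S :
  S \subset psi_set A I :\: I -> is_downset (I :|: S).
Proof.
move=> /subsetP SD; apply/is_downsetP => x y /setUP[xI|xS] yx; apply/setUP.
  by left; apply: downsetP yx.
move: (SD _ xS); rewrite !inE => /andP[/negPf-> /andP[_ /is_downsetP down]].
by have /setU1P[->|] := down x y (setU11 _ _) yx; [right | left].
Qed.

Lemma isom_boolean_Jitv_psi A I : isom_boolean (Jitv I (psi A I)).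
Proof.
(* Passing to the subtype [T] makes the subsets of [D] a full type [{set T}], as the Boolean algebra
   must be. *)
pose D := psi_set A I :\: I; pose T := {x : P | x \in D}.
have valD (S : {set T}) : val @: S \subset D.
  by apply/subsetP => _ /imsetP[x _ ->]; apply: valP.
pose f (S : {set T}) : J P := MkJ (downset_setU_psi (valD S)).
exists _, {set T}, f; split.
  move=> S1 S2; rewrite leEideal /=.
  apply/idP/idP => [/subsetP sub|sub]; last exact/setUS/imsetS.
  (* Elements of [T] lie outside [I], so [I] cancels from both sides of the inclusion. *)
  apply/subsetP => x xS; have /setUP[xI|] : val x \in I :|: val @: S2.
  - by apply: sub; rewrite in_setU imset_f ?orbT.
  - by have := valP x; rewrite in_setD xI.
  by rewrite mem_imset //; apply: val_inj.
apply/setP => K; rewrite mem_Jitv; apply/imsetP/andP => [[S _ ->]|[IK Kpsi]].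
  split; rewrite /= ?subsetUl // subUset subsetUl.
  exact: subset_trans (valD S) (subsetDl _ _).
(* The preimage of [K] is its trace on [D]; the bounds on [K] give back [K] as [I] together with
   this trace. *)
exists ([set x : T | val x \in K] : {set T}); first by rewrite in_setT.
apply/val_inj/setP => x; rewrite in_setU.
have [xI|xnI] /= := boolP (x \in I); first exact: (subsetP IK).
apply/idP/imsetP => [xK|[z + ->]]; last by rewrite inE.
have xD : x \in D by rewrite in_setD xnI (subsetP Kpsi).
by exists (Sub x xD); rewrite ?inE.
Qed.

End IdealIntervals.

Theorem theorem4p1 (d : Order.disp_t) (P : finPOrderType d) (A : {set P})
    (antiA : antichain A)
    (ncovA : forall u v : P, u \in A -> v \in A -> ~~ (u < v)) :
  [/\ [set: J P] = \bigcup_(I in J'' A) Jitv I (psi A I),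
      forall I I' : J P, I \in J'' A -> I' \in J'' A -> I != I' ->
        [disjoint Jitv I (psi A I) & Jitv I' (psi A I')]
    & forall I : J P, I \in J'' A -> isom_boolean (Jitv I (psi A I))].
Proof.
have incA : {in A &, forall u v, ~~ (u < v)} by move=> u v; apply: ncovA.
split=> [|I I' IJ I'J neqI|I _]; last exact: isom_boolean_Jitv_psi.
  apply/setP => K; rewrite in_setT; apply/esym/bigcupP.
  by exists (core A K); [apply: core_in_J'' | apply: mem_Jitv_core].
apply/pred0Pn => -[K /andP[KI KI']]; case/eqP: neqI.
by rewrite -(Jitv_coreE incA IJ KI) (Jitv_coreE incA I'J KI').
Qed.
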